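(* Suppose a TSP instance is formed by placing $n$ points independently and uniformly at random in the unit square $[0,1]^2$. Then the expected value of the ratio of the length of the worst (longest) local optimum of X-opt to the length of an optimal tour on this instance is $\Omega(\sqrt{n})$.
   Context: Euclidean TSP in the plane: given a finite set $X \subset \mathbb{R}^2$, a tour is a Hamiltonian cycle on $X$; edge $\{x,y\}$ has length equal to the Euclidean distance $d(x,y)$ and the length of a tour is the sum of its edge lengths. For an edge $e=\{x,y\}$, $L(e)$ denotes the closed line segment from $x$ to $y$. A tour is noncrossing if no two of its edges have intersecting line segments (other than at a shared endpoint). X-opt is the local search heuristic that repeatedly replaces two edges of the tour whose line segments intersect by two other edges so as to obtain a tour again; its local optima are exactly the noncrossing tours. *)

(* Defs.v *)
From HB Require Import structures.
From mathcomp Require Import all_boot all_order all_algebra all_fingroup.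
From mathcomp Require Import all_classical all_reals all_analysis.
Set Implicit Arguments. Unset Strict Implicit. Unset Printing Implicit Defensive.
Import Order.TTheory GRing.Theory Num.Theory.
Local Open Scope ring_scope.
Local Open Scope classical_set_scope.

Section TSP.
Variable R : realType.

Definition pt := (R * R)%type.

Definition dist (x y : pt) : R :=
  Num.sqrt ((x.1 - y.1) ^+ 2 + (x.2 - y.2) ^+ 2).

Definition segment (x y : pt) : set pt :=
  [set z | exists t : R, 0 <= t <= 1 /\
     z = ((1 - t) * x.1 + t * y.1, (1 - t) * x.2 + t * y.2)].

Variable n : nat.

(* An instance: n points indexed by 'I_n.  A tour (Hamiltonian cycle on the
   instance) is given by a cyclic ordering s : 'S_n of the indices; its k-th
   edge joins s k and s (k+1 mod n). *)
Definition tour_edge (s : 'S_n) (k : 'I_n) : 'I_n * 'I_n := (s k, s (ordS k)).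

Definition tour_length (p : 'I_n -> pt) (s : 'S_n) : R :=
  \sum_(k < n) dist (p (tour_edge s k).1) (p (tour_edge s k).2).

Definition noncrossing (p : 'I_n -> pt) (s : 'S_n) : Prop :=
  forall k l : 'I_n, k != l ->
    forall z : pt,
      segment (p (tour_edge s k).1) (p (tour_edge s k).2) z ->
      segment (p (tour_edge s l).1) (p (tour_edge s l).2) z ->
      (z = p (tour_edge s k).1 \/ z = p (tour_edge s k).2) /\
      (z = p (tour_edge s l).1 \/ z = p (tour_edge s l).2).

(* length of the worst (longest) local optimum of X-opt, i.e. of the longest
   noncrossing tour (0 if there is none; this only happens on a null set) *)
Definition worst_xopt_length (p : 'I_n -> pt) : R :=
  \big[Num.max/0]_(s : 'S_n | `[< noncrossing p s >]) tour_length p s.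

Definition opt_length (p : 'I_n -> pt) : R :=
  \big[Num.min/tour_length p 1%g]_(s : 'S_n) tour_length p s.

Definition xopt_ratio (p : 'I_n -> pt) : R :=
  worst_xopt_length p / opt_length p.

End TSP.

(* k-fold iterated integral over [0,1]^k with respect to Lebesgue measure:
   this is the expectation of F(U_1,...,U_k) for U_i iid uniform on [0,1]
   (for the nonnegative measurable functionals used below). *)
Fixpoint unif_expect (R : realType) (k : nat) (F : seq R -> \bar R) : \bar R :=
  match k with
  | 0 => F [::]
  | k'.+1 => (\int[@lebesgue_measure R]_(x in `[0%R, 1%R]) unif_expect k' (fun s => F (x :: s)))%E
  end.

Definition points_of_seq (R : realType) (n : nat) (c : seq R) : 'I_n -> pt R :=
  fun i => (nth 0 c (2 * i), nth 0 c (2 * i + 1)).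

Definition expected_xopt_ratio (R : realType) (n : nat) : \bar R :=
  unif_expect (2 * n) (fun c => (xopt_ratio (@points_of_seq R n c))%:E).

(* Main.v *)
(** Every set of [n] points of the unit square has a tour of length at most
    [9 sqrt n], so it is enough to find, with probability bounded below, a
    noncrossing tour of length linear in [n].  Visit the points above the line
    [y = 1/2] from left to right, then those below it from right to left.  The
    two chains cannot meet; the two edges joining them are harmless as soon as
    the leftmost and the rightmost points are above the line and their
    neighbours in [x]-order are below it.  Given the [x]-order and the sides of
    the line, the tour is fixed while the distances to the line remain
    independent, so each edge has expected length bounded below.  To avoid any
    measurability question about the ratio, the square is cut into finitely
    many cells and the expectation is bounded below by a function that is
    constant on the cells. *)
Require Import Defs.
From HB Require Import structures.
From mathcomp Require Import all_boot all_order all_algebra all_fingroup.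
From mathcomp Require Import all_classical all_reals all_analysis measurable_realfun.
From mathcomp Require Import ring lra zify.
Set Implicit Arguments. Unset Strict Implicit. Unset Printing Implicit Defensive.
Import Order.TTheory GRing.Theory Num.Theory.
Local Open Scope ring_scope.

(** * Lower bounds for iterated integrals by step functions *)

(** The integral of a nonnegative function is a supremum over the simple functions below it, and
    this supremum is monotone even when the functions are not measurable. *)
Lemma lower_integral_mono d (T : measurableType d) (R : realType)
    (mu : {measure set T -> \bar R}) (D : set T) (f g : T -> \bar R) :
  (forall x, D x -> 0 <= f x)%E -> (forall x, D x -> f x <= g x)%E ->
  (\int[mu]_(x in D) f x <= \int[mu]_(x in D) g x)%E.
Proof.
move=> f0 fg; rewrite !ge0_integralE//; last first.
  by move=> x Dx; exact: le_trans (f0 _ Dx) (fg _ Dx).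
apply: le_ereal_sup => _ [h hf <-]; exists h => // x.
by apply: le_trans (hf x) _; exact: lee_restrict.
Qed.

(** At each point at most one cell contributes to the step function with values [c], so it lies
    below [f]. Since the cells are open, their boundaries fall under the case where only [0 <= f] is
    known. *)
Lemma integral_ge_cells (R : realType) (A : finType) (l r c : A -> R)
    (f : R -> \bar R) :
  (forall a, 0 <= l a) -> (forall a, l a < r a) -> (forall a, r a <= 1) ->
  (forall a b x, l a < x < r a -> l b < x < r b -> a = b) ->
  (forall a, 0 <= c a) -> (forall x, 0 <= f x)%E ->
  (forall a x, l a < x < r a -> ((c a)%:E <= f x)%E) ->
  ((\sum_a (r a - l a) * c a)%:E <=
     \int[@lebesgue_measure R]_(x in `[0%R, 1%R]%classic) f x)%E.
Proof.
move=> l0 lr r1 disj c0 f0 cf.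
pose h (a : A) (x : R) : \bar R := ((c a)%:E * (\1_(`]l a, r a[%classic) x)%:E)%E.
have h0 a x : (0 <= h a x)%E by rewrite mule_ge0 ?lee_fin.
have mh a (D : set R) : measurable_fun D (h a).
  apply: measurable_funeM; apply/measurable_EFinP.
  exact: measurable_indic.
apply: (@le_trans _ _
  (\int[@lebesgue_measure R]_(x in `[0%R, 1%R]%classic) \sum_a h a x)%E).
  rewrite ge0_integral_sum//=; last by move=> a; exact: mh.
  rewrite -sumEFin; apply: lee_sum => a _; rewrite /h.
  rewrite ge0_integralZl//; last 2 first.
  - by apply/measurable_EFinP; exact: measurable_indic.
  - by rewrite lee_fin.
  rewrite integral_indic//= setIidl; last first.
    move=> x /=; rewrite !in_itv/= => /andP[lx xr].
    by rewrite (le_trans (l0 a) (ltW lx)) (le_trans (ltW xr) (r1 a)).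
  by rewrite lebesgue_measure_itv/= lte_fin lr -EFinB -EFinM mulrC.
apply: lower_integral_mono => x _; first exact: sume_ge0.
have [[a ax]|nx] := pselect (exists a, l a < x < r a).
  rewrite (bigD1 a)//= big1 ?adde0.
    rewrite /h indicE mem_set /= ?in_itv//= mule1; exact: cf.
  move=> b ba; rewrite /h indicE memNset ?mule0//= in_itv/= => bx.
  by move/eqP: ba; apply; exact: disj bx ax.
rewrite big1 ?f0// => a _; rewrite /h indicE memNset ?mule0//= in_itv/= => ax.
by apply: nx; exists a.
Qed.

Lemma unif_expect_ge0 (R : realType) (k : nat) (F : seq R -> \bar R) :
  (forall s, 0 <= F s)%E -> (0 <= unif_expect k F)%E.
Proof.
by elim: k F => //= k IH F F0; apply: integral_ge0 => x _; exact: IH.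
Qed.

Lemma sum_tuple_cons (R : nmodType) (C : finType) (n : nat) (G : seq C -> R) :
  \sum_(t : n.+1.-tuple C) G t = \sum_(a : C) \sum_(t : n.-tuple C) G (a :: t).
Proof.
rewrite pair_big /= (reindex (fun at_ : C * n.-tuple C => cons_tuple at_.1 at_.2)) //=.
exists (fun t : n.+1.-tuple C => (thead t, [tuple of behead t])).
  by move=> [a t] _; rewrite /= theadE; congr pair; exact: val_inj.
by move=> t _; rewrite /= [RHS]tuple_eta; exact: val_inj.
Qed.

(* [F] need not be measurable: the iterated integrals are then lower
   integrals, which are still monotone, so that a minorant that is constant on
   the cells is enough. *)
Lemma unif_expect_ge_cells (R : realType) (A B : finType) (lA rA : A -> R)
    (lB rB : B -> R) (c0 : A * B) (n : nat) (F : seq R -> \bar R)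
    (G : seq (A * B) -> R) :
  (forall a, 0 <= lA a) -> (forall a, rA a - lA a = #|A|%:R^-1) ->
  (forall a, rA a <= 1) ->
  (forall a b x, lA a < x < rA a -> lA b < x < rA b -> a = b) ->
  (forall a, 0 <= lB a) -> (forall a, rB a - lB a = #|B|%:R^-1) ->
  (forall a, rB a <= 1) ->
  (forall a b x, lB a < x < rB a -> lB b < x < rB b -> a = b) ->
  (forall s, 0 <= F s)%E -> (forall s, 0 <= G s) ->
  (forall s c, size s = n -> size c = (2 * n)%N ->
     (forall i, (i < n)%N ->
        lA (nth c0 s i).1 < nth 0 c (2 * i) < rA (nth c0 s i).1 /\
        lB (nth c0 s i).2 < nth 0 c (2 * i + 1) < rB (nth c0 s i).2) ->
     ((G s)%:E <= F c)%E) ->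
  (((#|A| * #|B|)%:R^-1 ^+ n * \sum_(t : n.-tuple (A * B)) G t)%:E <=
     unif_expect (2 * n) F)%E.
Proof.
move=> lA0 wA rA1 dA lB0 wB rB1 dB.
have A0 : 0 < #|A|%:R :> R by rewrite ltr0n; apply/card_gt0P; exists c0.1.
have B0 : 0 < #|B|%:R :> R by rewrite ltr0n; apply/card_gt0P; exists c0.2.
have lrA a : lA a < rA a by rewrite -subr_gt0 wA invr_gt0.
have lrB a : lB a < rB a by rewrite -subr_gt0 wB invr_gt0.
elim: n F G => [|n IH] F G F0 G0 GF.
  rewrite expr0 mul1r muln0 /= (big_pred1 [tuple]); last first.
    by move=> t; apply/esym/eqP; exact: tuple0.
  exact: GF.
rewrite mulnS /= sum_tuple_cons.
pose S a b : R := \sum_(t : n.-tuple (A * B)) G ((a, b) :: t).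
have S0 a b : 0 <= S a b by apply: sumr_ge0.
pose w : R := (#|A| * #|B|)%:R^-1 ^+ n.
have w0 : 0 <= w by rewrite exprn_ge0 ?invr_ge0 ?ler0n.
(* The factor contributed by the first point is split into the widths of its two cells, one for each
   coordinate. *)
have -> : (#|A| * #|B|)%:R^-1 ^+ n.+1 * \sum_a \sum_(t : n.-tuple (A * B)) G (a :: t)
    = \sum_a (rA a - lA a) * (\sum_b (rB b - lB b) * (w * S a b)).
  rewrite [RHS](eq_bigr (fun a =>
      #|A|%:R^-1 * #|B|%:R^-1 * w * \sum_b S a b)); last first.
    move=> a _; rewrite wA (eq_bigr (fun b => #|B|%:R^-1 * w * S a b)).
      by rewrite -mulr_sumr !mulrA.
    by move=> b _; rewrite wB mulrA.
  rewrite exprS -/w.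
  rewrite -mulr_sumr [in RHS]pair_big/= natrM invfM.
  by congr (_ * _); apply: eq_bigr => -[].
apply: integral_ge_cells => //.
- move=> a; apply: sumr_ge0 => b _; rewrite mulr_ge0 ?mulr_ge0//.
  by rewrite subr_ge0 ltW.
- move=> x; apply: integral_ge0 => y _; exact: unif_expect_ge0.
move=> a x ax; apply: integral_ge_cells => //.
- by move=> b; rewrite mulr_ge0.
- by move=> y; exact: unif_expect_ge0.
move=> b y yb.
(* The first point is frozen: its coordinates in [F], its cell in [G]. *)
apply: (IH (fun s => F [:: x, y & s]) (fun s => G ((a, b) :: s))) => // s c ss sc H.
apply: GF => /=; [by rewrite ss|by rewrite sc mulnS|].
move=> [|i] Hi; first by rewrite muln0.
have -> : (2 * i.+1 = (2 * i).+2)%N by rewrite mulnS.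
exact: H.
Qed.

(** * Sorting permutations and cyclic successors *)

Lemma sorting_perm (d : Order.disp_t) (T : orderType d) (n : nat)
    (K : 'I_n -> T) :
  exists s : 'S_n, forall i j : 'I_n, (i <= j)%N -> (K (s i) <= K (s j))%O.
Proof.
pose r : rel 'I_n := fun i j => (K i <= K j)%O.
have rtot : total r by move=> i j; exact: le_total.
have rtr : transitive r by move=> i j k; exact: le_trans.
have : perm_eq (sort r (enum 'I_n)) (ord_tuple n).
  by rewrite val_ord_tuple perm_sort.
move=> /tuple_permP[s sE]; exists s => i j ij.
have srt : sorted r [tuple tnth (ord_tuple n) (s i) | i < n].
  by rewrite -sE; exact: sort_sorted.
have := sorted_leq_nth rtr (fun i => le_refl (K i)) i srt.
move=> /(_ i j); rewrite !inE size_tuple !ltn_ord => /(_ isT isT ij).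
by rewrite -!tnth_nth !tnth_mktuple !tnth_ord_tuple.
Qed.

Lemma ordS_widen (n : nat) (i : 'I_n) :
  ordS (widen_ord (leqnSn n) i) = lift ord0 i.
Proof. by apply: val_inj; rewrite /= modn_small// ltnS ltn_ord. Qed.

Lemma ordS_max (n : nat) : ordS (@ord_max n) = ord0.
Proof. by apply: val_inj; rewrite /= modnn. Qed.

(** * Distances and the upper bound for the optimal tour *)

Section EuclideanPlane.
Variable R : realType.
Implicit Types p q : pt R.

Lemma dist_ge0 p q : 0 <= dist p q.
Proof. exact: sqrtr_ge0. Qed.

Lemma dist_le p q (a b : R) :
  `|p.1 - q.1| <= a -> `|p.2 - q.2| <= b -> dist p q <= a + b.
Proof.
move=> ha hb; have a0 := le_trans (normr_ge0 _) ha.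
have b0 := le_trans (normr_ge0 _) hb.
rewrite -[leRHS]ger0_norm ?addr_ge0// -sqrtr_sqr ler_sqrt ?sqr_ge0//.
rewrite -[X in X + _]real_normK ?num_real// -[X in _ + X]real_normK ?num_real//.
have := normr_ge0 (p.1 - q.1); have := normr_ge0 (p.2 - q.2); nra.
Qed.

Lemma dist_ge_snd p q : `|p.2 - q.2| <= dist p q.
Proof. by rewrite -sqrtr_sqr ler_sqrt ?addr_ge0 ?sqr_ge0// lerDr sqr_ge0. Qed.

Lemma dist_gt0 p q : p.1 != q.1 -> 0 < dist p q.
Proof.
by move=> pq; rewrite sqrtr_gt0 ltr_pwDl ?sqr_ge0// exprn_even_gt0//= subr_eq0.
Qed.

Lemma tour_length_ge0 (n : nat) (p : 'I_n -> pt R) s : 0 <= tour_length p s.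
Proof. by apply: sumr_ge0 => i _; exact: dist_ge0. Qed.

(* Visiting the points strip by strip, each strip from bottom to top: sorting
   along [2 * strip + y] makes every step at most twice the increase of the
   key plus the width of a strip, and the key increases telescope. *)
Lemma opt_length_le (n : nat) (p : 'I_n -> pt R) :
  (forall i, 0 <= (p i).1 <= 1) -> (forall i, 0 <= (p i).2 <= 1) ->
  (0 < n)%N -> opt_length p <= 9 * Num.sqrt n%:R.
Proof.
case: n p => // n p px py _.
set w := Num.sqrt n.+1%:R : R.
have w2 : w ^+ 2 = n.+1%:R by rewrite sqr_sqrtr ?ler0n.
have w1 : 1 <= w by rewrite -(sqrtr1 R) ler_sqrt ?ler0n// ler1n.
have w0 : 0 < w by exact: lt_le_trans w1.
(* With strips of width [w^-1], the key is at most [2 * w + 1] and the [n] widths add up to at most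
   [w]. With 2 for the closing edge this makes [5 * w + 4], at most [9 * w] since [1 <= w]. *)
pose t i : nat := Num.truncn ((p i).1 * w).
have tP i : (t i)%:R <= (p i).1 * w < (t i).+1%:R.
  by apply: Num.Theory.truncn_itv; case/andP: (px i) => x0 _; exact: mulr_ge0 x0 (ltW w0).
pose K i : R := 2 * (t i)%:R + (p i).2.
have [s sP] := sorting_perm K.
have step i j : K i <= K j -> dist (p i) (p j) <= 2 * (K j - K i) + w^-1.
  have wV : w^-1 * w = 1 by rewrite mulVf ?gt_eqF.
  have wV0 : 0 < w^-1 by rewrite invr_gt0.
  have := tP i; have := tP j; have := py i; have := py j.
  move=> /andP[yj0 yj1] /andP[yi0 yi1] /andP[tj1 tj2] /andP[ti1 ti2].
  rewrite /K => Kij.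
  have tij : (t i <= t j)%N.
    rewrite leqNgt; apply/negP => tji.
    have : ((t j).+1%:R <= (t i)%:R :> R) by rewrite ler_nat.
    rewrite -natr1; lra.
  have [d td] : exists d, t j = (t i + d)%N by exists (t j - t i)%N; rewrite subnKC.
  have xij : `|(p i).1 - (p j).1| <= (d%:R + 1) * w^-1.
    rewrite -(ler_pM2r w0) -mulrA wV mulr1 -[X in _ * X](gtr0_norm w0) -normrM.
    rewrite mulrBl ler_norml.
    move: tj1 tj2 ti1 ti2; rewrite td -!natr1 !natrD => *.
    by have d0 := ler0n R d; apply/andP; split; lra.
  have wV1 : w^-1 <= 1 by rewrite invf_le1.
  (* Within a strip the increase of the ordinate pays for the vertical move. When the strip number
     grows by [d.+1], the key grows by at least [2 * d + 1], and twice this pays for a vertical move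
     of at most 1 and the extra widths. *)
  case: d td xij => [|d] td xij.
    move: Kij; rewrite td addn0 => Kij.
    have yij : `|(p i).2 - (p j).2| <= (p j).2 - (p i).2.
      by rewrite distrC ger0_norm; lra.
    by apply: le_trans (dist_le xij yij) _; rewrite add0r mul1r; lra.
  have yij : `|(p i).2 - (p j).2| <= 1 by rewrite ler_norml; apply/andP; split; lra.
  apply: le_trans (dist_le xij yij) _.
  rewrite td natrD -!natr1.
  have d0 : 0 <= d%:R :> R by exact: ler0n.
  nra.
have close i j : dist (p i) (p j) <= 1 + 1.
  have := px i; have := px j; have := py i; have := py j.
  by move=> /andP[??] /andP[??] /andP[??] /andP[??];
     apply: dist_le; rewrite ler_norml; apply/andP; split; lra.
apply: (@le_trans _ _ (tour_length p s)); first exact: bigmin_le.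
rewrite /tour_length big_ord_recr /=.
rewrite (_ : 9 * w = (9 * w - 2) + 2); last by ring.
apply: lerD; last by rewrite (le_trans (close _ _)).
apply: (@le_trans _ _
  (\sum_(i < n) (2 * (K (s (lift ord0 i)) - K (s (widen_ord (leqnSn n) i))) + w^-1))).
  apply: ler_sum => i _; rewrite ordS_widen; apply: step; apply: sP.
  by rewrite /= leqnSn.
rewrite big_split /= -mulr_sumr sumr_const card_ord.
pose u k := K (s (inord k)).
have -> : \sum_(i < n) (K (s (lift ord0 i)) - K (s (widen_ord (leqnSn n) i))) = u n - u 0%N.
  rewrite -telescope_sumr// big_mkord; apply: eq_bigr => i _; congr (K (s _) - K (s _)).
    by apply: val_inj; rewrite /= inordK// ltnS ltn_ord.
  by apply: val_inj; rewrite /= inordK// ltnS ltnW.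
have uB k : 0 <= u k <= 2 * w + 1.
  rewrite /u /K; move: (inord k) => i; have := tP (s i); have := px (s i).
  have := py (s i).
  move=> /andP[y0 y1] /andP[x0 x1] /andP[t0 t1].
  have := ler0n R (t (s i)) => t00.
  apply/andP; split; first lra.
  nra.
have wn : w^-1 *+ n <= w.
  rewrite -mulr_natr mulrC ler_pdivrMr// -expr2 w2 ler_nat//.
have /andP[? ?] := uB n; have /andP[? ?] := uB 0%N.
lra.
Qed.

Lemma opt_length_gt0 (n : nat) (p : 'I_n -> pt R) :
  (1 < n)%N -> injective (fun i => (p i).1) -> 0 < opt_length p.
Proof.
case: n p => [|[|n]]// p _ pinj.
have T0 s : 0 < tour_length p s.
  rewrite /tour_length (bigD1 ord0)//= ltr_pwDl//; last first.
    by apply: sumr_ge0 => i _; exact: dist_ge0.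
  by apply: dist_gt0; apply/negP => /eqP/pinj/perm_inj/(congr1 val).
by apply: lt_bigmin.
Qed.

Lemma opt_length_ge0 (n : nat) (p : 'I_n -> pt R) : 0 <= opt_length p.
Proof. by apply: le_bigmin => [|s _]; exact: tour_length_ge0. Qed.

Lemma worst_xopt_length_ge0 (n : nat) (p : 'I_n -> pt R) :
  0 <= worst_xopt_length p.
Proof. exact: bigmax_ge_id. Qed.

Lemma xopt_ratio_ge0 (n : nat) (p : 'I_n -> pt R) : 0 <= xopt_ratio p.
Proof. by rewrite divr_ge0 ?opt_length_ge0 ?worst_xopt_length_ge0. Qed.

(** The tour [s] competes in the maximum of the numerator. Distinct abscissae make the optimal
    length positive, so that its upper bound passes to inverses. *)
Lemma xopt_ratio_ge (n : nat) (p : 'I_n -> pt R) (s : 'S_n) :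
  (1 < n)%N -> (forall i, 0 <= (p i).1 <= 1) -> (forall i, 0 <= (p i).2 <= 1) ->
  injective (fun i => (p i).1) -> noncrossing p s ->
  tour_length p s / (9 * Num.sqrt n%:R) <= xopt_ratio p.
Proof.
move=> n1 px py pinj ps.
have n0 : (0 < n)%N by exact: ltn_trans n1.
apply: ler_pM => //.
- exact: tour_length_ge0.
- by apply: le_bigmax_cond; apply/asboolP.
- by rewrite lef_pV2 ?opt_length_le// posrE ?opt_length_gt0// mulr_gt0// sqrtr_gt0 ltr0n.
Qed.

End EuclideanPlane.

(** * Segments in the plane and a criterion for noncrossing tours *)

Section Noncrossing.
Variable R : realType.
Implicit Types a b c u v z : pt R.

(** The condition that [noncrossing] imposes on a single pair of edges. *)
Definition meet_at_endpoints a b c d : Prop :=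
  forall z, segment a b z -> segment c d z ->
    (z = a \/ z = b) /\ (z = c \/ z = d).

Lemma segmentC a b : segment a b = segment b a.
Proof.
apply/seteqP; split => z [t [/andP[t0 t1] ->]]; exists (1 - t);
  by (split; [apply/andP; split; lra|congr pair; ring]).
Qed.

Lemma meet_at_endpoints_swap a b c d :
  meet_at_endpoints a b c d -> meet_at_endpoints c d a b.
Proof. by move=> H z z1 z2; have [] := H z z2 z1. Qed.

Lemma meet_at_endpoints_revl a b c d :
  meet_at_endpoints a b c d -> meet_at_endpoints b a c d.
Proof. by move=> H z; rewrite segmentC => z1 z2; have [[]] := H z z1 z2; tauto. Qed.

Lemma meet_at_endpoints_revr a b c d :
  meet_at_endpoints a b c d -> meet_at_endpoints a b d c.
Proof.
by move=> H; apply/meet_at_endpoints_swap/meet_at_endpoints_revl/meet_at_endpoints_swap.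
Qed.

Lemma conv_lt (x y m t : R) :
  x < m -> y < m -> 0 <= t -> t <= 1 -> (1 - t) * x + t * y < m.
Proof.
move=> xm ym; rewrite le_eqVlt => /orP[/eqP <- _|t0 t1]; first by lra.
have : t * y < t * m by rewrite ltr_pM2l.
have : (1 - t) * x <= (1 - t) * m by rewrite ler_wpM2l ?subr_ge0// ltW.
lra.
Qed.

Lemma conv_gt (x y m t : R) :
  m < x -> m < y -> 0 <= t -> t <= 1 -> m < (1 - t) * x + t * y.
Proof.
move=> xm ym t0 t1; have := @conv_lt (- x) (- y) (- m) t; rewrite !ltrN2.
by move=> /(_ xm ym t0 t1); lra.
Qed.

(** The abscissa of a common point, computed on the first segment, lies to the left of [c] and [d],
    hence strictly to the left of every point of the second segment, itself included. *)
Lemma meet_at_endpoints_ltx a b c d :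
  a.1 < c.1 -> a.1 < d.1 -> b.1 < c.1 -> b.1 < d.1 -> meet_at_endpoints a b c d.
Proof.
move=> ac ad bc bd z [t [/andP[t0 t1] ->]] [r [/andP[r0 r1] [e _]]]; exfalso.
have lc := conv_lt ac bc t0 t1.
have ld := conv_lt ad bd t0 t1.
by have := conv_gt lc ld r0 r1; rewrite -e ltxx.
Qed.

Lemma meet_at_endpoints_lty a b c d (h : R) :
  a.2 < h -> b.2 < h -> h < c.2 -> h < d.2 -> meet_at_endpoints a b c d.
Proof.
move=> ah bh ch dh z [t [/andP[t0 t1] ->]] [r [/andP[r0 r1] [_ e]]]; exfalso.
by have := conv_lt ah bh t0 t1; have := conv_gt ch dh r0 r1; rewrite -e; lra.
Qed.

Lemma meet_at_endpoints_consecutive a b c :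
  a.1 < b.1 -> b.1 < c.1 -> meet_at_endpoints a b b c.
Proof.
move=> ab bc z [t [/andP[t0 t1] ->]] [r [/andP[r0 r1] [e _]]].
have -> : t = 1 by nra.
have E : ((1 - 1) * a.1 + 1 * b.1, (1 - 1) * a.2 + 1 * b.2) = b.
  by case: b {ab bc e} => ? ?; congr pair => /=; ring.
by rewrite E; split; [right|left].
Qed.

(* The edge from [u] down to [v] is steeper than the edge from [u] to [a]. *)
Lemma meet_at_endpoints_fork a u v (h : R) :
  (a.1 < v.1 < u.1) || (u.1 < v.1 < a.1) -> v.2 < h -> h < u.2 -> h < a.2 ->
  meet_at_endpoints u a u v.
Proof.
move=> x vh uh ah z [t [/andP[t0 t1] ->]] [r [/andP[r0 r1] [e1 e2]]].
have -> : t = 0.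
  (* Away from [u], equal abscissae force [t < r] because [v] is horizontally closer to [u]; but
     then the ordinate has dropped strictly more on the edge to [v]. *)
  apply/eqP; rewrite eq_le t0 andbT leNgt; apply/negP => t_gt0.
  have E1 : t * (a.1 - u.1) = r * (v.1 - u.1) by lra.
  have E2 : t * (a.2 - u.2) = r * (v.2 - u.2) by lra.
  have tr : t < r by case/orP: x => /andP[? ?]; nra.
  nra.
have E : ((1 - 0) * u.1 + 0 * a.1, (1 - 0) * u.2 + 0 * a.2) = u.
  by case: u {x uh e1 e2} => ? ?; congr pair => /=; ring.
by rewrite E; split; left.
Qed.

(** Edges of one chain are consecutive or separated by a vertical line, and the line [y = h]
    separates the two chains. No other point has its abscissa between those of [u0] and [l0], or of
    [l1] and [u1], so a joining edge can only touch its neighbours in the tour: as a fork at its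
    upper end, as consecutive edges at its lower end. *)
Lemma noncrossing_bitonic (n : nat) (p : 'I_n -> pt R) (s : 'S_n) (h : R)
    (up : pred 'I_n) (u0 l0 l1 u1 : 'I_n) :
  (forall i, up i -> h < (p i).2) -> (forall i, ~~ up i -> (p i).2 < h) ->
  up u0 -> ~~ up l0 -> ~~ up l1 -> up u1 ->
  (p u0).1 < (p l0).1 < (p l1).1 -> (p l1).1 < (p u1).1 ->
  (forall i, i != u0 -> i != l0 -> (p l0).1 < (p i).1) ->
  (forall i, i != u1 -> i != l1 -> (p i).1 < (p l1).1) ->
  (forall i j : 'I_n, (i < j)%N -> up (s j) ->
     up (s i) /\ (p (s i)).1 < (p (s j)).1) ->
  (forall i j : 'I_n, (i < j)%N -> ~~ up (s i) ->
     ~~ up (s j) /\ (p (s j)).1 < (p (s i)).1) ->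
  noncrossing p s.
Proof.
case: n p s up u0 l0 l1 u1 => [|n] p s up u0 l0 l1 u1; first by case: u0.
move=> upP loP upu0 lol0 lol1 upu1 /andP[ul0 l01] lu1 left right upS loS.
(* [u0] is visited first, [l0] last, and [l1] immediately after [u1] *)
have s0 : s ord0 = u0.
  have -> : ord0 = (s^-1)%g u0; last by rewrite permKV.
  apply/eqP; apply/negPn/negP => ne.
  have lt : (@ord0 n < (s^-1)%g u0)%N by rewrite lt0n eq_sym.
  have := upS _ _ lt; rewrite permKV => /(_ upu0)[us lts].
  have : s ord0 != u0 by apply: contraTneq lts => ->; rewrite ltxx.
  move=> /left; have : s ord0 != l0 by apply: contraTneq us => ->.
  by move=> ne2 /(_ ne2); move: lts ul0; lra.
have sn : s ord_max = l0.
  have -> : ord_max = (s^-1)%g l0; last by rewrite permKV.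
  apply/eqP; apply/negPn/negP => ne.
  have lt : ((s^-1)%g l0 < @ord_max n)%N.
    by rewrite ltn_neqAle -ltnS ltn_ord andbT eq_sym.
  have := loS _ _ lt; rewrite permKV => /(_ lol0)[us lts].
  have : s ord_max != u0 by apply: contraNneq us => ->.
  move=> /left; have : s ord_max != l0 by apply: contraTneq lts => ->; rewrite ltxx.
  by move=> ne2 /(_ ne2); move: lts ul0; lra.
have ordS_val (i : 'I_n.+1) : (i < n)%N -> (ordS i = i.+1 :> nat)%N.
  by move=> ltin; rewrite /= modn_small.
have switch (i : 'I_n.+1) (j := ordS i) :
    (i < n)%N -> up (s i) -> ~~ up (s j) -> s i = u1 /\ s j = l1.
  move=> ltin ui lj.
  have between (m : 'I_n.+1) : (m <= i)%N || (j <= m)%N.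
    by rewrite /j ordS_val// leqNgt orbC; case: ltnP.
  (* At position [j] or later [u1] would be a lower point; strictly before [i] it would have the
     upper point [s i] to its right. The argument for [l1] is symmetric. *)
  split.
    have E : u1 = s ((s^-1)%g u1) by rewrite permKV.
    set m := (s^-1)%g u1 in E.
    have : (m <= i)%N.
      have := between m; rewrite orbC [(_ <= _)%N in X in X || _]leq_eqVlt.
      case/orP => // /orP[/eqP/val_inj jm|jm].
        by move: lj; rewrite jm -E upu1.
      by have [] := loS _ _ jm lj; rewrite -E upu1.
    rewrite leq_eqVlt => /orP[/eqP/val_inj <- //|mi].
    have [_] := upS _ _ mi ui; rewrite -E => lt.
    have /right H : s i != u1 by apply: contraTneq lt => ->; rewrite ltxx.
    have /H : s i != l1 by apply: contraTneq ui => ->.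
    by move=> H'; exfalso; move: lt lu1 H'; lra.
  have E : l1 = s ((s^-1)%g l1) by rewrite permKV.
  set m := (s^-1)%g l1 in E.
  have : (j <= m)%N.
    have := between m; rewrite [(_ <= _)%N in X in X || _]leq_eqVlt.
    case/orP => // /orP[/eqP/val_inj mi|mi].
      by move: ui; rewrite -mi -E (negPf lol1).
    by have [] := upS _ _ mi ui; rewrite -E (negPf lol1).
  rewrite leq_eqVlt => /orP[/eqP/val_inj -> //|jm].
  have [_] := loS _ _ jm lj; rewrite -E => lt.
  have /right H : s j != u1 by apply: contraNneq lj => ->.
  have /H : s j != l1 by apply: contraTneq lt => ->; rewrite ltxx.
  by move=> H'; exfalso; move: lt H'; lra.
suff main (k l : 'I_n.+1) : (k < l)%N ->
    meet_at_endpoints (p (s k)) (p (s (ordS k))) (p (s l)) (p (s (ordS l))).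
  move=> k l; rewrite -val_eqE neq_ltn => /orP[kl|lk]; first exact: main.
  exact/meet_at_endpoints_swap/main.
move=> kl.
have kn : (k < n)%N by rewrite (leq_trans kl)// -ltnS ltn_ord.
have kSk : (k < ordS k)%N by rewrite ordS_val.
have neq_lt (i j : 'I_n.+1) : (i < j)%N -> s i != s j.
  by move=> ij; rewrite (inj_eq perm_inj) -val_eqE neq_ltn ij.
(* First case: [l] is the closing edge, from [l0] back to [u0]. The edge [k] shares an endpoint with
   it or lies entirely to the right of [l0]. *)
have [ln|ln] := leqP n l.
  have -> : l = ord_max by apply: val_inj; apply/eqP; rewrite eqn_leq ln -ltnS ltn_ord.
  rewrite ordS_max s0 sn.
  have [uSk|lSk] := boolP (up (s (ordS k))).
    have [uk ltk] := upS _ _ kSk uSk.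
    have Sk0 : (p l0).1 < (p (s (ordS k))).1.
      apply: left; last by apply: contraTneq uSk => ->.
      by rewrite -s0 eq_sym; apply: neq_lt; exact: leq_ltn_trans kSk.
    have [k0|k0] := eqVneq (s k) u0.
      rewrite k0; apply: meet_at_endpoints_revr.
      by apply: (@meet_at_endpoints_fork _ _ _ h); rewrite ?ul0 ?Sk0 ?orbT ?loP ?upP.
    have k0' : (p l0).1 < (p (s k)).1.
      by apply: left => //; apply: contraTneq uk => ->.
    by apply: meet_at_endpoints_swap; apply: meet_at_endpoints_ltx => //; lra.
  have [uk|lk] := boolP (up (s k)).
    have [-> ->] := switch _ kn uk lSk.
    by apply: meet_at_endpoints_swap; apply: meet_at_endpoints_ltx => //; lra.
  have [_ ltk] := loS _ _ kSk lk.
  have k0 : (p l0).1 < (p (s k)).1.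
    apply: left; first by apply: contraNneq lk => ->.
    by rewrite -sn; apply: neq_lt; rewrite /= kn.
  have [Sk0|Sk0] := eqVneq (s (ordS k)) l0.
    rewrite Sk0; apply/meet_at_endpoints_swap/meet_at_endpoints_revl/meet_at_endpoints_revr.
    exact: meet_at_endpoints_consecutive.
  have Sk0' : (p l0).1 < (p (s (ordS k))).1.
    by apply: left => //; apply: contraNneq lSk => ->.
  by apply: meet_at_endpoints_swap; apply: meet_at_endpoints_ltx => //; lra.
have lSl : (l < ordS l)%N by rewrite ordS_val.
have Skl : (ordS k <= l)%N by rewrite ordS_val.
have [ul|ll] := boolP (up (s l)).
  have [uk ltkl] := upS _ _ kl ul.
  have uSk : up (s (ordS k)).
    move: Skl; rewrite leq_eqVlt => /orP[/eqP/val_inj -> //|H].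
    by have [] := upS _ _ H ul.
  have [_ ltk] := upS _ _ kSk uSk.
  have [uSl|lSl'] := boolP (up (s (ordS l))).
    have [_ ltl] := upS _ _ lSl uSl.
    move: Skl; rewrite leq_eqVlt => /orP[/eqP/val_inj E|H].
      rewrite -E in ltl *; exact: meet_at_endpoints_consecutive.
    have [_ ltSkl] := upS _ _ H ul.
    by apply: meet_at_endpoints_ltx => //; lra.
  (* Here [l] is the edge from [u1] down to [l1], and [k] is an upper edge that ends at [u1] or lies
     to the left of [l1]. *)
  have [E1 E2] := switch _ ln ul lSl'; rewrite E2 E1.
  have kl1 : (p (s k)).1 < (p l1).1.
    apply: right; last by apply: contraTneq uk => ->.
    by rewrite -E1; exact: neq_lt.
  have [E|E] := eqVneq (s (ordS k)) u1.
    rewrite E; apply: meet_at_endpoints_revl.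
    by apply: (@meet_at_endpoints_fork _ _ _ h); rewrite ?kl1 ?lu1 ?loP ?upP.
  have Skl1 : (p (s (ordS k))).1 < (p l1).1.
    by apply: right => //; apply: contraTneq uSk => ->.
  by apply: meet_at_endpoints_ltx => //; lra.
have [lSl' ltl] := loS _ _ lSl ll.
have [uk|lk] := boolP (up (s k)).
  have [uSk|lSk] := boolP (up (s (ordS k))).
    by apply/meet_at_endpoints_swap/(@meet_at_endpoints_lty _ _ _ _ h); rewrite ?loP ?upP.
  (* Now [k] is the edge from [u1] to [l1], and [l] is a lower edge that starts at [l1] or lies to
     its left. *)
  have [E1 E2] := switch _ kn uk lSk; rewrite E2 E1.
  have Sll1 : (p (s (ordS l))).1 < (p l1).1.
    apply: right; first by apply: contraNneq lSl' => ->.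
    by rewrite eq_sym -E2; apply: neq_lt; exact: leq_ltn_trans Skl lSl.
  have [E|E] := eqVneq (s l) l1.
    rewrite E; apply/meet_at_endpoints_swap/meet_at_endpoints_revl/meet_at_endpoints_revr.
    exact: meet_at_endpoints_consecutive.
  have ll1 : (p (s l)).1 < (p l1).1.
    by apply: right => //; apply: contraNneq ll => ->.
  by apply: meet_at_endpoints_swap; apply: meet_at_endpoints_ltx => //; lra.
have [lSk ltk] := loS _ _ kSk lk.
move: Skl; rewrite leq_eqVlt => /orP[/eqP/val_inj E|H].
  rewrite -E in ltl *; apply/meet_at_endpoints_swap.
  apply/meet_at_endpoints_revl/meet_at_endpoints_revr.
  exact: meet_at_endpoints_consecutive.
have [_ ltSkl] := loS _ _ H lSk.
by apply: meet_at_endpoints_swap; apply: meet_at_endpoints_ltx => //; lra.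
Qed.

End Noncrossing.

(** * Counting finite functions *)

Lemma sum_tuple_ffun (R : nmodType) (C : finType) (c0 : C) (n : nat)
    (G : {ffun 'I_n -> C} -> R) :
  \sum_(t : n.-tuple C) G [ffun i : 'I_n => nth c0 t i] = \sum_f G f.
Proof.
rewrite (reindex (fun f : {ffun 'I_n -> C} => [tuple f i | i < n])).
  apply: eq_bigr => f _; congr G; apply/ffunP => i.
  by rewrite ffunE -(tnth_nth c0) tnth_mktuple.
exists (fun t : n.-tuple C => [ffun i => tnth t i]).
  by move=> f _; apply/ffunP => i; rewrite ffunE tnth_mktuple.
by move=> t _; apply: eq_from_tnth => i; rewrite tnth_mktuple ffunE.
Qed.

Lemma sum_ffun_pair (R : nmodType) (I A B : finType)
    (G : {ffun I -> A * B} -> R) :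
  \sum_f G f = \sum_(x : {ffun I -> A}) \sum_(y : {ffun I -> B})
                 G [ffun i => (x i, y i)].
Proof.
rewrite pair_big /= (reindex (fun xy : {ffun I -> A} * {ffun I -> B} =>
  [ffun i => (xy.1 i, xy.2 i)])) //=.
exists (fun f : {ffun I -> A * B} => ([ffun i => (f i).1], [ffun i => (f i).2])).
  by move=> [x y] _; congr pair; apply/ffunP => i; rewrite !ffunE.
by move=> f _; apply/ffunP => i; rewrite !ffunE; case: (f i).
Qed.

(** Prescribing a value costs at most a factor [#|D|]; a repeated entry of [r] costs nothing more,
    whence an inequality. *)
Lemma card_ffun_agree (I D : finType) (g : I -> D) (r : seq I) :
  (0 < #|D|)%N ->
  (#|D| ^ #|I| <=
     #|[set f : {ffun I -> D} | all (fun i => f i == g i) r]| * #|D| ^ size r)%N.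
Proof.
move=> D0; pose F i : pred D := if i \in r then pred1 (g i) else predT.
have -> : #|[set f : {ffun I -> D} | all (fun i => f i == g i) r]| = #|family F|.
  apply: eq_card => f; rewrite inE; apply/allP/familyP => H i.
    by rewrite /F; case: ifP => // /H.
  by move=> ir; have := H i; rewrite /F ir.
rewrite card_family foldrE big_map big_enum /=.
rewrite (bigID (mem r)) /= big1 ?mul1n; last first.
  by move=> i ir; rewrite /F ir card1.
rewrite (eq_bigr (fun=> #|D|)); last by move=> i /negPf; rewrite /F => ->.
rewrite prod_nat_const -expnD leq_pexp2l// -(cardC (mem r)) addnC leq_add2l.
exact: card_size.
Qed.

Lemma card_inj_ffuns_ge (n M : nat) :
  (0 < n)%N -> (2 * n ^ 2 <= M)%N ->
  (M ^ n <= 2 * #|[set x : {ffun 'I_n -> 'I_M} | injectiveb x]|)%N.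
Proof.
move=> n0 nM; rewrite card_inj_ffuns !card_ord.
(* Birthday bound: the proportion of injective choices of [j] values is at least [1 - j / (2 * n)],
   which is 1/2 at [j = n]. *)
have H j : (j <= n)%N -> ((2 * n - j) * M ^ j <= 2 * n * M ^_ j)%N.
  elim: j => [|j IH] jn; first by rewrite subn0 expn0 ffactn0.
  have step : ((2 * n - j.+1) * M <= (2 * n - j) * (M - j))%N.
    rewrite subnS -subn1 mulnBl mulnBr mul1n leq_sub2l//.
    apply: leq_trans nM; rewrite -mulnn mulnA.
    by rewrite leq_mul ?leq_subr// ltnW.
  rewrite expnSr ffactnSr.
  apply: (@leq_trans (M ^ j * ((2 * n - j) * (M - j)))%N).
    by rewrite mulnCA leq_mul2l step orbT.
  rewrite !mulnA leq_mul2r [(M ^ j * _)%N]mulnC.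
  by rewrite IH ?orbT// ltnW.
have := H n (leqnn n).
by rewrite {1}mul2n -addnn addnK [(2 * n)%N]mulnC -mulnA leq_pmul2l.
Qed.

Lemma unit_cell_inj (R : realDomainType) (a b : nat) (x : R) :
  a%:R < x < a%:R + 1 -> b%:R < x < b%:R + 1 -> a = b.
Proof.
move=> /andP[a1 a2] /andP[b1 b2]; apply/eqP; rewrite eqn_leq.
apply/andP; split; rewrite -ltnS -(ltr_nat R) -natr1.
  exact: lt_trans a1 b2.
exact: lt_trans b1 a2.
Qed.

(** * The tour determined by columns and sides *)

Section BitonicTour.
Variables (n : nat) (x : 'I_n.+4 -> nat) (b : 'I_n.+4 -> bool) (M : nat).

(** This sends a rank to the index of the point having that rank, counted from the left. *)
Definition xrank : 'S_n.+4 := sval (cid (sorting_perm x)).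

(** These are [u0], [l0], [l1], [u1] of [noncrossing_bitonic], distinct since there are at least
    four points. *)
Definition ends : seq 'I_n.+4 :=
  [:: xrank ord0; xrank (inord 1); xrank (inord n.+2); xrank ord_max].

Definition ends_up (i : 'I_n.+4) : bool :=
  (i == xrank ord0) || (i == xrank ord_max).

(* As [x < M], the keys [2 * M - x] put the lower points, from right to left,
   after all the upper ones. *)
Definition bitonic_tour : 'S_n.+4 :=
  sval (cid (sorting_perm (fun i => if b i then x i else 2 * M - x i)%N)).

Hypotheses (x_inj : injective x) (xM : forall i, (x i < M)%N).

Lemma xrank_lt (i j : 'I_n.+4) : (i < j)%N -> (x (xrank i) < x (xrank j))%N.
Proof.
move=> ij; rewrite ltn_neqAle; apply/andP; split; last first.
  by have := svalP (cid (sorting_perm x)) i j (ltnW ij).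
by rewrite (inj_eq x_inj) (inj_eq perm_inj) -val_eqE neq_ltn ij.
Qed.

Lemma bitonic_tour_lt (i j : 'I_n.+4) (s := bitonic_tour) : (i < j)%N ->
  if b (s i) then b (s j) ==> (x (s i) < x (s j))%N
  else ~~ b (s j) && (x (s j) < x (s i))%N.
Proof.
move=> ij.
have := svalP (cid (sorting_perm (fun i => if b i then x i else 2 * M - x i)%N))
  i j (ltnW ij).
rewrite -/bitonic_tour -/s leEnat.
have : x (s i) != x (s j).
  by rewrite (inj_eq x_inj) (inj_eq perm_inj) -val_eqE neq_ltn ij.
have := xM (s i); have := xM (s j).
by case: (b (s i)); case: (b (s j)) => /=; lia.
Qed.

(** Only the order of the abscissae and the sides of the line enter, so one tour serves all
    instances with the same cells. *)
Lemma bitonic_tour_noncrossing (R : realType) (p : 'I_n.+4 -> pt R) (h : R) :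
  (forall i j, (x i < x j)%N -> (p i).1 < (p j).1) ->
  (forall i, b i -> h < (p i).2) -> (forall i, ~~ b i -> (p i).2 < h) ->
  all (fun i => b i == ends_up i) ends ->
  noncrossing p bitonic_tour.
Proof.
move=> px pu pl.
have v1 : (inord 1 : 'I_n.+4) = 1%N :> nat by rewrite inordK.
have v2 : (inord n.+2 : 'I_n.+4) = n.+2 :> nat by rewrite inordK.
have E (i j : 'I_n.+4) : (xrank i == xrank j) = (i == j :> nat).
  by rewrite (inj_eq perm_inj).
rewrite /= /ends_up !E v1 v2 /= eqxx eqSS [(_ == n.+3)]eqn_leq ltnn andbF /=.
move=> /and5P[/eqP u0 /eqP l0 /eqP l1 /eqP u1 _].
have rk i : i = xrank ((xrank^-1)%g i) by rewrite permKV.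
apply: (@noncrossing_bitonic _ _ _ _ h b (xrank ord0) (xrank (inord 1))
  (xrank (inord n.+2)) (xrank ord_max)) => //.
- by rewrite l0.
- by rewrite l1.
- by rewrite !px// xrank_lt// v1 ?v2.
- by rewrite px// xrank_lt// v2.
- move=> i; rewrite [i]rk !E v1 => ne0 ne1; apply/px/xrank_lt.
  by rewrite v1; case: (val _) ne0 ne1 => [|[]].
- move=> i; rewrite [i]rk !E v2 /= => ne0 ne1; apply/px/xrank_lt.
  rewrite v2 ltn_neqAle ne1 /= -ltnS ltn_neqAle ne0 /=.
  by rewrite -ltnS ltn_ord.
- move=> i j ij bj; have := bitonic_tour_lt ij; rewrite bj /=.
  by case: ifP => // bi lt; split=> //; exact: px.
- move=> i j ij /negPf bi; have := bitonic_tour_lt ij; rewrite bi.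
  by move=> /andP[bj lt]; split=> //; exact: px.
Qed.

End BitonicTour.

(** * A minorant of the ratio that is constant on cells *)

(** An edge counts for 1/6 when its ends lie in the nearest and the farthest of the three layers, in
    this order: the middle layer separates their distances to the line, so the ordinates differ by
    at least 1/6 whatever the sides. The denominator bounds the optimal length. *)
Definition ratio_minorant (R : realType) (n M : nat) (x : 'I_n.+4 -> 'I_M)
    (b : 'I_n.+4 -> bool) (t : 'I_n.+4 -> 'I_3) : R :=
  let s := bitonic_tour x b M in
  if injectiveb x && all (fun i => b i == ends_up x i) (ends x)
  then (\sum_k ((t (s k) == ord0) && (t (s (ordS k)) == ord_max))%:R / 6)
         / (9 * Num.sqrt n.+4%:R)
  else 0.

(* The boolean is the side of the line [y = 1/2], the ordinal the distance to
   that line, in units of 1/6 and rounded down. *)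
Definition cell_bot (R : realType) (c : bool * 'I_3) : R :=
  if c.1 then 1 / 2 + c.2%:R / 6 else 1 / 2 - (c.2%:R + 1) / 6.

Definition cell_top (R : realType) (c : bool * 'I_3) : R :=
  if c.1 then 1 / 2 + (c.2%:R + 1) / 6 else 1 / 2 - c.2%:R / 6.

Lemma cell_le2 (R : realType) (t : 'I_3) : t%:R <= 2%:R :> R.
Proof. by rewrite ler_nat -ltnS. Qed.

Lemma cell_bot_ge0 (R : realType) c : 0 <= cell_bot R c.
Proof.
case: c => [[] t]; rewrite /cell_bot /=; have := cell_le2 R t;
  have := ler0n R t; lra.
Qed.

Lemma cell_top_le1 (R : realType) c : cell_top R c <= 1.
Proof.
case: c => [[] t]; rewrite /cell_top /=; have := cell_le2 R t;
  have := ler0n R t; lra.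
Qed.

Lemma cell_inj (R : realType) c d (y : R) :
  cell_bot R c < y < cell_top R c -> cell_bot R d < y < cell_top R d -> c = d.
Proof.
case: c d => [[] t] [[] u]; rewrite /cell_bot /cell_top /= => /andP[a1 a2] /andP[b1 b2].
- congr pair; apply: val_inj; apply: (@unit_cell_inj R _ _ (6 * (y - 1 / 2)));
    by apply/andP; split; lra.
- by exfalso; have := ler0n R t; have := ler0n R u; lra.
- by exfalso; have := ler0n R t; have := ler0n R u; lra.
- congr pair; apply: val_inj; apply: (@unit_cell_inj R _ _ (6 * (1 / 2 - y)));
    by apply/andP; split; lra.
Qed.

Lemma ratio_minorant_ge0 (R : realType) n M x b t :
  0 <= @ratio_minorant R n M x b t.
Proof.
rewrite /ratio_minorant; case: ifP => // _.
rewrite divr_ge0 ?mulr_ge0 ?sqrtr_ge0//.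
by apply: sumr_ge0 => k _; rewrite divr_ge0.
Qed.

Lemma ratio_minorant_le (R : realType) (n M : nat) (x : 'I_n.+4 -> 'I_M)
    (b : 'I_n.+4 -> bool) (t : 'I_n.+4 -> 'I_3) (p : 'I_n.+4 -> pt R) :
  (forall i, (x i)%:R / M%:R < (p i).1 < ((x i)%:R + 1) / M%:R) ->
  (forall i, cell_bot R (b i, t i) < (p i).2 < cell_top R (b i, t i)) ->
  ratio_minorant R x b t <= xopt_ratio p.
Proof.
move=> px py; rewrite /ratio_minorant; case: ifP => [|_]; last exact: xopt_ratio_ge0.
move=> /andP[/injectiveP x_inj good_ends].
set s := bitonic_tour _ _ _.
have M0 : 0 < M%:R :> R by rewrite ltr0n; exact: leq_ltn_trans (ltn_ord (x ord0)).
have xinj : injective (fun i => x i : nat) by move=> i j /val_inj/x_inj.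
have xlt i j : (x i < x j)%N -> (p i).1 < (p j).1.
  move=> ij; have /andP[_ xi] := px i; have /andP[xj _] := px j.
  apply: lt_le_trans xi _; apply: le_trans (ltW xj).
  by rewrite ler_pM2r ?invr_gt0// natr1 ler_nat.
have pinj : injective (fun i => (p i).1).
  move=> i j /= pij; apply: xinj; apply/eqP; rewrite eqn_leq.
  by apply/andP; split; rewrite leqNgt; apply/negP => /xlt; rewrite pij ltxx.
have yP i : 0 < (p i).2 < 1.
  have /andP[y1 y2] := py i; apply/andP; split.
    exact: le_lt_trans (cell_bot_ge0 _ _) y1.
  exact: lt_le_trans y2 (cell_top_le1 _ _).
apply: le_trans (@xopt_ratio_ge _ _ p s _ _ _ pinj _) => //.
- apply: ler_wpM2r; first by rewrite invr_ge0 mulr_ge0 ?sqrtr_ge0.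
  apply: ler_sum => k _; apply: le_trans (dist_ge_snd _ _) => /=.
  move: (py (s k)) (py (s (ordS k))).
  case: (eqVneq (t (s k)) ord0) => [->|_]; last by rewrite mul0r.
  case: (eqVneq (t (s (ordS k))) ord_max) => [->|_]; last by rewrite mul0r.
  rewrite /cell_bot /cell_top /= ler_normr.
  by case: ifP; case: ifP => _ _ /andP[? ?] /andP[? ?]; apply/orP;
    (by left; lra) || (by right; lra).
- move=> i; have /andP[x1 x2] := px i; apply/andP; split.
    by apply: le_trans (ltW x1); rewrite divr_ge0.
  apply: le_trans (ltW x2) _; rewrite ler_pdivrMr// mul1r natr1 ler_nat.
  exact: ltn_ord.
- by move=> i; have /andP[? ?] := yP i; apply/andP; split; exact: ltW.
- apply: (@bitonic_tour_noncrossing _ _ _ _ xinj _ _ p (1 / 2)) => //.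
  + move=> i bi; have /andP[y1 _] := py i; move: y1; rewrite /cell_bot /= bi.
    by have := ler0n R (t i); lra.
  + move=> i /negPf bi; have /andP[_ y2] := py i; move: y2; rewrite /cell_top /= bi.
    by have := ler0n R (t i); lra.
Qed.

(** * The average of the minorant, and the conclusion *)

Lemma sum_ge_card (R : numDomainType) (T : finType) (P : pred T) (W : T -> R)
    (c v : R) :
  c <= #|[set x | P x]|%:R -> 0 <= v -> (forall x, P x -> v <= W x) ->
  c * v <= \sum_(x | P x) W x.
Proof.
move=> cP v0 vW; apply: (@le_trans _ _ (\sum_(x | P x) v)); last exact: ler_sum.
rewrite sumr_const -cardsE -[leRHS]mulr_natl.
exact: ler_wpM2r.
Qed.

(** Columns are distinct with probability at least 1/2 and the four ends lie on the right sides with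
    probability at least 1/16. The tour being then fixed, each edge counts with probability 1/9, for
    an expected length of at least [N / 54]. Dividing by [9 * w] leaves [w / (54 * 288)], as
    [288 = 2 * 16 * 9]. *)
Lemma sum_ratio_minorant_ge (R : realType) (n : nat) (M := (2 * n.+4 ^ 2)%N) :
  Num.sqrt n.+4%:R / (54 * 288) * (M * 6)%:R ^+ n.+4 <=
  \sum_(x : {ffun 'I_n.+4 -> 'I_M}) \sum_(b : {ffun 'I_n.+4 -> bool})
    \sum_(t : {ffun 'I_n.+4 -> 'I_3}) ratio_minorant R x b t.
Proof.
set N := n.+4; set w := Num.sqrt N%:R : R.
have w0 : 0 < w by rewrite sqrtr_gt0 ltr0n.
have wn : w ^+ 2 = N%:R by rewrite sqr_sqrtr ?ler0n.
have good_edges (s : 'S_N) :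
    N%:R / 54 * 3 ^+ N <= \sum_(t : {ffun 'I_N -> 'I_3})
      \sum_k ((t (s k) == ord0) && (t (s (ordS k)) == ord_max))%:R / 6 :> R.
  rewrite exchange_big /=.
  rewrite (_ : _ / _ * _ = \sum_(k < N) (3 ^+ N / 54)); last first.
    by rewrite sumr_const card_ord -mulr_natl; ring.
  apply: ler_sum => k _.
  (* The two ends of an edge are different points, so the conditions on their layers are
     compatible. *)
  have skS : s (ordS k) != s k.
    rewrite (inj_eq perm_inj) -val_eqE /=; have := ltn_ord k.
    rewrite leq_eqVlt => /orP[/eqP e|kN]; last by rewrite modn_small// gtn_eqF.
    by rewrite e modnn; case: (nat_of_ord k) e.
  have := @card_ffun_agree _ _ (fun i => if i == s k then ord0 else ord_max : 'I_3)
    [:: s k; s (ordS k)].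
  rewrite !card_ord => /(_ isT); rewrite -(ler_nat R) natrX natrM /= => H.
  rewrite -mulr_suml -natr_sum.
  set c := #|_| in H.
  rewrite (_ : (\sum_t _)%N = c); last first.
    rewrite /c -sum1dep_card [RHS]big_mkcond /=; apply: eq_bigr => t _.
    by rewrite eqxx (negPf skS) andbT; case: (_ && _).
  lra.
have good_bits (x : 'I_N -> nat) :
    2 ^+ N / 16 <= #|[set b : {ffun 'I_N -> bool} |
                      all (fun i => b i == ends_up x i) (ends x)]|%:R :> R.
  have := @card_ffun_agree 'I_N bool (ends_up x) (ends x).
  rewrite card_bool card_ord => /(_ isT); rewrite -(ler_nat R) natrX natrM /=.
  by lra.
have good_x : M%:R ^+ N / 2 <=
    #|[set x : {ffun 'I_N -> 'I_M} | injectiveb x]|%:R :> R.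
  have := @card_inj_ffuns_ge N M isT (leqnn _); rewrite -(ler_nat R) natrX natrM.
  by lra.
pose V : R := N%:R / 54 * 3 ^+ N / (9 * w).
have V0 : 0 <= V.
  by apply: divr_ge0; apply: mulr_ge0 => //; exact: ltW.
apply: (@le_trans _ _ (\sum_(x : {ffun 'I_N -> 'I_M} | injectiveb x)
    \sum_(b : {ffun 'I_N -> bool} |
           all (fun i => b i == ends_up (fun i => x i : nat) i)
               (ends (fun i => x i : nat))) V)); last first.
  rewrite big_mkcond; apply: ler_sum => x _; case: ifP => [x_inj|_]; last first.
    apply: sumr_ge0 => b _; apply: sumr_ge0 => t _; exact: ratio_minorant_ge0.
  rewrite big_mkcond; apply: ler_sum => b _; case: ifP => [good_ends|_]; last first.
    by apply: sumr_ge0 => t _; exact: ratio_minorant_ge0.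
  rewrite /ratio_minorant x_inj good_ends /= -mulr_suml.
  by apply: ler_wpM2r; [rewrite invr_ge0 mulr_ge0 ?ltW|exact: good_edges].
apply: (@le_trans _ _ (M%:R ^+ N / 2 * (2 ^+ N / 16 * V))).
  have e6 : (6 : R) = 2 * 3 by rewrite -natrM.
  rewrite natrM exprMn e6 exprMn /V -wn le_eqVlt; apply/orP; left; apply/eqP.
  by field; rewrite gt_eqF.
have p2 : 0 <= 2 ^+ N / 16 :> R by rewrite divr_ge0 ?exprn_ge0.
apply: sum_ge_card => //.
  exact: mulr_ge0.
by move=> x _; apply: sum_ge_card => //; exact: good_bits.
Qed.

Theorem theorem3 (R : realType) :
  exists c : R, 0 < c /\
  exists N : nat, forall n : nat, (N <= n)%N ->
    ((c * Num.sqrt (n%:R))%:E <= expected_xopt_ratio R n)%E.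
Proof.
exists (54 * 288)^-1; split; first by rewrite invr_gt0 mulr_gt0 ?ltr0n.
(* Four points are required for the two ends on each side. *)
exists 4%N => n' n4.
have [n ->] : exists n, n' = n.+4 by exists (n' - 4)%N; rewrite -addn4 subnK.
(* The number of columns is quadratic in the number of points, as the birthday bound demands. *)
pose M := (2 * n.+4 ^ 2)%N.
have M0 : (0 < M)%N by rewrite muln_gt0 expn_gt0.
have M0R : 0 < M%:R :> R by rewrite ltr0n.
pose c0 : 'I_M * (bool * 'I_3) := (Ordinal M0, (true, ord0)).
pose G (f : {ffun 'I_n.+4 -> 'I_M * (bool * 'I_3)}) : R :=
  ratio_minorant R (fun i => (f i).1) (fun i => (f i).2.1) (fun i => (f i).2.2).
apply: (@le_trans _ _ (((#|'I_M| * #|{: bool * 'I_3}|)%:R^-1 ^+ n.+4 *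
    \sum_(t : n.+4.-tuple ('I_M * (bool * 'I_3)))
       G [ffun i : 'I_n.+4 => nth c0 t i])%:E)%E).
  rewrite lee_fin sum_tuple_ffun card_prod card_bool !card_ord.
  rewrite sum_ffun_pair.
  under eq_bigr do rewrite sum_ffun_pair.
  rewrite exprVn ler_pdivlMl ?exprn_gt0 ?ltr0n ?muln_gt0 ?M0//.
  apply: le_trans (le_trans (sum_ratio_minorant_ge R n) _).
    by rewrite le_eqVlt; apply/orP; left; apply/eqP; rewrite -/M; ring.
  rewrite le_eqVlt; apply/orP; left; apply/eqP.
  apply: eq_bigr => x _; apply: eq_bigr => b _; apply: eq_bigr => t _.
  by rewrite /G; congr ratio_minorant; apply/funext => i; rewrite !ffunE.
(* The grid has [M] columns of width [1 / M] and six rows of height 1/6, three on each side of the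
   line. *)
apply: (@unif_expect_ge_cells R _ _ (fun a : 'I_M => a%:R / M%:R)
  (fun a : 'I_M => (a%:R + 1) / M%:R) (@cell_bot R) (@cell_top R) c0 n.+4 _
  (fun s => G [ffun i : 'I_n.+4 => nth c0 s i])).
- by move=> a; rewrite divr_ge0.
- by move=> a; rewrite card_ord; field; rewrite gt_eqF.
- move=> a; rewrite ler_pdivrMr// mul1r natr1 ler_nat; exact: ltn_ord.
- move=> a b x; rewrite !ltr_pdivrMr// !ltr_pdivlMr// => ax bx.
  by apply: val_inj; exact: unit_cell_inj ax bx.
- exact: cell_bot_ge0.
- move=> c; rewrite card_prod card_bool card_ord /cell_bot /cell_top.
  by case: ifP => _; field.
- exact: cell_top_le1.
- exact: cell_inj.
- by move=> s; rewrite lee_fin; exact: xopt_ratio_ge0.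
- by move=> s; exact: ratio_minorant_ge0.
move=> s c _ _ H; rewrite lee_fin; apply: ratio_minorant_le => i; rewrite ffunE.
  by have [] := H i (ltn_ord i).
by rewrite -surjective_pairing; have [] := H i (ltn_ord i).
Qed.
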